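(* Let $(W,S)$ be an arbitrary Coxeter system, let $\underline{w}=(s_1,\ldots,s_n)$ be any expression (a finite sequence of elements of $S$), and let $q_1,\ldots,q_n$ and $q_1',\ldots,q_n'$ be the polynomials in $\mathbb{R}[x_1,\ldots,x_n]$ associated with $\underline{w}$ as defined in the context. With respect to the lexicographical order induced by $x_n>\cdots>x_2>x_1$, $\{q_1,\ldots,q_n\}$ is a Gröbner basis of the ideal $(q_1,\ldots,q_n)$ and $\{q_1',\ldots,q_n'\}$ is the reduced Gröbner basis of the ideal $(q_1,\ldots,q_n)$. As a corollary, $\mathbb{R}[x_1,\ldots,x_n]/(q_1,\ldots,q_n)$ has the $\mathbb{R}$-basis $\{x_1^{\varepsilon_1}x_2^{\varepsilon_2}\cdots x_n^{\varepsilon_n}\mid\varepsilon_i\in\{0,1\},\ i=1,\ldots,n\}$.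
   Context: A Coxeter system $(W,S)$ has $S$ finite, $W=\langle s\in S\mid (st)^{m_{st}}=\mathrm{id}\text{ for } s,t\in S,\ m_{st}<\infty\rangle$, with $m_{ss}=1$ and $m_{st}=m_{ts}\in\{2,3,\ldots\}\cup\{\infty\}$ for $s\ne t$. Convention: $\pi/m_{st}=0$ if $m_{st}=\infty$. Let $\tilde R_{\underline{w}}=(\tilde r_{ij})_{1\le i,j\le n}$ with $\tilde r_{ij}=\cos\frac{\pi}{m_{s_is_j}}$ if $i<j$ and $\tilde r_{ij}=0$ if $i\ge j$, and let $Q_{\underline{w}}=(q_{ij})_{1\le i,j\le n}:=\tilde R_{\underline{w}}+\tilde R_{\underline{w}}^2+\cdots+\tilde R_{\underline{w}}^n$. Define $$q_m:=x_m^2-\Bigl(\sum_{l=1}^{m-1}q_{lm}x_l\Bigr)^2=x_m^2-\sum_{1\le i\le j\le m-1}c^m_{i,j}x_ix_j,\qquad c^m_{i,j}=(2-\delta_{ij})q_{im}q_{jm}.$$ The polynomials $q_k'$ are obtained inductively by using the earlier relations to eliminate the square terms $x_1^2,\ldots,x_{k-1}^2$ from $q_k$: $q_1'=q_1$ and $q_k'=q_k+\sum_{i=1}^{k-1}c^k_{i,i}\,q_i'$. Thus $q_k'=x_k^2-\sum_{1\le i<j\le k-1}d^k_{i,j}x_ix_j$ for some real numbers $d^k_{i,j}$, and $(q_1',\ldots,q_n')=(q_1,\ldots,q_n)$. For a fixed monomial order, a finite generating set $G$ of an ideal $I$ is a Gröbner basis if the ideal generated by the leading monomials of the elements of $I$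 equals the ideal generated by the leading monomials of the elements of $G$. It is reduced if each element of $G$ has leading coefficient $1$ and its leading monomial does not divide any other monomial occurring in the polynomials of $G$. *)

(* Defs.v *)
From HB Require Import structures.
From mathcomp Require Import all_boot all_order all_algebra.
From mathcomp Require Import reals.
(* boolp and trigo are not imported: the notations of the analysis library
   clash with those of mpoly. *)
From mathcomp Require boolp trigo.
From mathcomp Require Import mpoly.

Set Implicit Arguments.
Unset Strict Implicit.
Unset Printing Implicit Defensive.

Import Order.TTheory GRing.Theory Num.Theory.
Local Open Scope ring_scope.
Local Open Scope quotient_scope.

(* The exponents of a Coxeter matrix are of type [option nat], with [None] for
   infinity: a pair (s, t) with [m s t = None] contributes no relation. *)
Definition coxeter_relations (S : Type) (m : S -> S -> option nat)
    (G : groupType) (f : S -> G) : Prop :=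
  forall s t k, m s t = Some k -> ((f s * f t) ^+ k = 1)%g.

(* [S] is a subset of [W] through the injection [cox_emb]; that
   [W = < s in S | (s t)^(m s t) = 1 >] is the universal property of the
   presentation. *)
Record coxeter_system := CoxeterSystem {
  cox_group : groupType;
  cox_gen : finType;
  cox_emb : cox_gen -> cox_group;
  cox_mat : cox_gen -> cox_gen -> option nat;
  cox_emb_inj : injective cox_emb;
  cox_mat_diag : forall s, cox_mat s s = Some 1%N;
  cox_mat_sym : forall s t, cox_mat s t = cox_mat t s;
  cox_mat_off : forall s t k, s != t -> cox_mat s t = Some k -> (2 <= k)%N;
  cox_rel : coxeter_relations cox_mat cox_emb;
  cox_univ : forall (G : groupType) (f : cox_gen -> G),
    coxeter_relations cox_mat f ->
    exists2 phi : cox_group -> G,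
      {morph phi : x y / (x * y)%g} /\ (forall s, phi (cox_emb s) = f s)
    & forall psi : cox_group -> G,
        {morph psi : x y / (x * y)%g} -> (forall s, psi (cox_emb s) = f s) ->
        psi =1 phi
}.

Section CoxeterPolynomials.
Variables (R : realType) (C : coxeter_system).

Definition cox_angle (s t : cox_gen C) : R :=
  if cox_mat s t is Some k then trigo.pi / k%:R else 0.

Variables (n : nat) (w : n.-tuple (cox_gen C)).

Definition cox_Rtilde : 'M[R]_n :=
  \matrix_(i, j)
    if (i < j)%N then trigo.cos (cox_angle (tnth w i) (tnth w j)) else 0.

Definition cox_Q : 'M[R]_n := \sum_(1 <= k < n.+1) cox_Rtilde ^+ k.

Definition cox_poly (m : 'I_n) : {mpoly R[n]} :=
  'X_m ^+ 2 - (\sum_(l < n | (l < m)%N) cox_Q l m *: 'X_l) ^+ 2.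

Definition cox_coef (m i j : 'I_n) : R :=
  (2 - (i == j)%:R) * cox_Q i m * cox_Q j m.

Lemma cox_polyE (m : 'I_n) :
  cox_poly m = 'X_m ^+ 2 -
    \sum_(j < n | (j < m)%N) \sum_(i < n | (i <= j)%N)
      cox_coef m i j *: ('X_i * 'X_j).
Proof.
rewrite /cox_poly; congr (_ - _); rewrite expr2 mulr_suml.
pose F (i j : 'I_n) : {mpoly R[n]} :=
  (cox_Q i m *: 'X_i) * (cox_Q j m *: 'X_j).
have FC i j : F i j = F j i by rewrite /F mulrC.
under eq_bigr => i _ do rewrite mulr_sumr -/(F i _).
have splitF (i : 'I_n) : (i < m)%N -> \sum_(j < n | (j < m)%N) F i j =
    \sum_(j < n | (j < i)%N) F i j + F i i
    + \sum_(j < n | (j < m)%N && (i < j)%N) F i j.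
  move=> im; rewrite (bigID (fun j : 'I_n => (i < j)%N)) /= addrC.
  congr (_ + _).
  rewrite (bigD1 i) /=; last by rewrite im ltnn.
  rewrite addrC; congr (_ + _); apply: eq_bigl => j.
  rewrite -val_eqE /= -andbA -leqNgt (andbC (j <= i)%N) -ltn_neqAle.
  by case: (ltnP j i) => ji; rewrite ?andbF // (ltn_trans ji im).
rewrite (eq_bigr _ splitF) big_split /=.
rewrite [X in _ + X](exchange_big_dep (fun j : 'I_n => (j < m)%N)) /=;
  last by move=> i j _ /andP[].
rewrite -big_split /=; apply: eq_bigr => j jm.
rewrite [RHS](bigD1 j) //=.
have -> : \sum_(i < n | [&& (i < m)%N, (j < m)%N & (i < j)%N]) F i j
          = \sum_(i < n | (i < j)%N) F i j.
  apply: eq_bigl => i; rewrite jm /=.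
  by case: (ltnP i j) => ij; rewrite ?andbF // (ltn_trans ij jm).
have -> : \sum_(i < n | (i < j)%N) F j i = \sum_(i < n | (i < j)%N) F i j.
  by apply: eq_bigr => i _; rewrite FC.
have FE i : F i j = (cox_Q i m * cox_Q j m) *: ('X_i * 'X_j).
  by rewrite /F -scalerAl -scalerAr scalerA.
rewrite addrAC addrC; congr (_ + _).
  by rewrite FE /cox_coef eqxx addrK mul1r.
rewrite -big_split /=; apply: eq_big => [i|i ij].
  by rewrite [LHS]ltn_neqAle andbC.
rewrite FE /cox_coef.
have /negPf-> : i != j by rewrite -val_eqE /= ltn_eqF.
by rewrite subr0 -scalerDl -mulrA mulr_natl mulr2n.
Qed.

(* The recursion runs on a bound for the index, see [cox_poly_redE]. *)
Fixpoint cox_poly_red_rec (b : nat) (k : 'I_n) : {mpoly R[n]} :=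
  if b is b'.+1 then
    cox_poly k +
    \sum_(i < n | (i < k)%N) cox_coef k i i *: cox_poly_red_rec b' i
  else 0.

Definition cox_poly_red (k : 'I_n) : {mpoly R[n]} := cox_poly_red_rec k.+1 k.

Lemma cox_poly_redE (k : 'I_n) :
  cox_poly_red k =
    cox_poly k + \sum_(i < n | (i < k)%N) cox_coef k i i *: cox_poly_red i.
Proof.
have indep b : forall b' (i : 'I_n), (i < b)%N -> (i < b')%N ->
    cox_poly_red_rec b i = cox_poly_red_rec b' i.
  elim: b => // b IHb [//|b'] i ib ib' /=; congr (_ + _).
  by apply: eq_bigr => j ji; congr (_ *: _); apply: IHb; apply: (leq_trans ji).
rewrite {1}/cox_poly_red /=; congr (_ + _); apply: eq_bigr => i ik.
by congr (_ *: _); apply: indep.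
Qed.

End CoxeterPolynomials.

Section Ideals.
Variables (n : nat) (R : comNzRingType).
Implicit Types (P : {mpoly R[n]} -> Prop) (f : {mpoly R[n]}).

Definition ideal_gen P f : Prop :=
  exists s : seq ({mpoly R[n]} * {mpoly R[n]}),
    (forall p, p \in s -> P p.2) /\ f = \sum_(p <- s) p.1 * p.2.

Definition ideal_pred P : {pred {mpoly R[n]}} :=
  fun f => boolp.asbool (ideal_gen P f).

Lemma ideal_predP P f : reflect (ideal_gen P f) (f \in ideal_pred P).
Proof. exact: boolp.asboolP. Qed.

Lemma ideal_genM P f g : ideal_gen P f -> ideal_gen P (g * f).
Proof.
case=> s [Ps ->]; exists [seq (g * p.1, p.2) | p <- s]; split.
  by move=> _ /mapP [p ps ->] /=; apply: Ps.
by rewrite big_map mulr_sumr; apply: eq_bigr => p _; rewrite mulrA.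
Qed.

Lemma ideal_pred_zmod_closed P : zmod_closed (ideal_pred P).
Proof.
split; first by apply/ideal_predP; exists [::]; rewrite big_nil.
move=> f g /ideal_predP [s [Ps ->]] /ideal_predP Ig.
have [t [Pt gE]] := ideal_genM (-1) Ig.
apply/ideal_predP; exists (s ++ t); split; last by rewrite big_cat -gE mulN1r.
by move=> p; rewrite mem_cat => /orP [/Ps|/Pt].
Qed.

HB.instance Definition _ P :=
  GRing.isZmodClosed.Build {mpoly R[n]} (ideal_pred P)
    (ideal_pred_zmod_closed P).

(* The quotient by the ideal generated by P. The library makes a quotient a
   ring only when the ideal is proper; the R-module structure needs no such
   condition. *)
Definition mpoly_quot P := Quotient.quot (ideal_pred P).

Section QuotientModule.
Variable P : {mpoly R[n]} -> Prop.
Local Notation Q := (mpoly_quot P).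

HB.instance Definition _ := GRing.Zmodule.on Q.
HB.instance Definition _ : EqQuotient _ (Quotient.equiv (ideal_pred P)) Q :=
  EqQuotient.on Q.

Lemma quot_eqP f g : reflect (\pi_Q f = \pi_Q g) (f - g \in ideal_pred P).
Proof. by rewrite Quotient.idealrBE; apply: eqP. Qed.

Definition quot_scale (a : R) (x : Q) : Q := \pi_Q (a *: repr x).

Lemma quot_scale_pi a f : quot_scale a (\pi_Q f) = \pi_Q (a *: f).
Proof.
apply/quot_eqP; rewrite -scalerBr -mul_mpolyC.
apply/ideal_predP/ideal_genM/ideal_predP/quot_eqP.
by rewrite reprK.
Qed.

Lemma quot_piD f g : \pi_Q (f + g) = \pi_Q f + \pi_Q g.
Proof. exact: (raddfD (\pi_(Quotient.quot (ideal_pred P)))). Qed.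

Fact quot_scaleA a b (x : Q) :
  quot_scale a (quot_scale b x) = quot_scale (a * b) x.
Proof. by rewrite -[x]reprK (quot_scale_pi b) !quot_scale_pi scalerA. Qed.

Fact quot_scale1 : left_id 1 quot_scale.
Proof. by move=> x; rewrite -[x]reprK quot_scale_pi scale1r. Qed.

Fact quot_scaleDr : right_distributive quot_scale +%R.
Proof.
move=> a x y; rewrite -[x]reprK -[y]reprK -quot_piD !quot_scale_pi.
by rewrite scalerDr quot_piD.
Qed.

Fact quot_scaleDl (x : Q) : {morph quot_scale^~ x : a b / a + b}.
Proof.
by move=> a b /=; rewrite -[x]reprK !quot_scale_pi scalerDl quot_piD.
Qed.

HB.instance Definition _ :=
  GRing.Zmodule_isLmodule.Build R Q
    quot_scaleA quot_scale1 quot_scaleDr quot_scaleDl.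

End QuotientModule.
End Ideals.

Section Basis.
Variables (R : nzRingType) (V : lmodType R) (I : finType) (b : I -> V).

Definition lin_indep : Prop :=
  forall a : I -> R, \sum_i a i *: b i = 0 -> forall i, a i = 0.

Definition spanning : Prop :=
  forall v : V, exists a : I -> R, v = \sum_i a i *: b i.

Definition is_basis : Prop := lin_indep /\ spanning.

End Basis.

Definition sqfree_mnm (n : nat) (e : {ffun 'I_n -> bool}) : 'X_{1..n} :=
  [multinom (e i : nat) | i < n].

Record monomial_order (n : nat) := MonomialOrder {
  mo_le :> rel 'X_{1..n};
  mo_anti : antisymmetric mo_le;
  mo_trans : transitive mo_le;
  mo_total : total mo_le;
  mo_add : forall m m1 m2, mo_le m1 m2 -> mo_le (m + m1)%MM (m + m2)%MM;
  mo_ge0 : forall m, mo_le 0%MM m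
}.

(* The last variable is the largest: the variables are 'X_i with i in
   {0, ..., n - 1} and the exponents are compared from i = n - 1 downwards. *)
Definition lex_lt (n : nat) : rel 'X_{1..n} := fun m1 m2 =>
  [exists i : 'I_n, (m1 i < m2 i)%N &&
    [forall j : 'I_n, (i < j)%N ==> (m1 j == m2 j)]].

Definition lex_le (n : nat) : rel 'X_{1..n} := fun m1 m2 =>
  (m1 == m2) || lex_lt m1 m2.

Section Lex.
Variable n : nat.
Implicit Types m : 'X_{1..n}.

Lemma lex_ltP m1 m2 :
  reflect (exists2 i : 'I_n, (m1 i < m2 i)%N &
             forall j : 'I_n, (i < j)%N -> m1 j = m2 j)
          (lex_lt m1 m2).
Proof.
apply: (iffP existsP) => [[i /andP[lt /forallP E]]|[i lt E]]; exists i => //.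
  by move=> j ij; apply/eqP; have /implyP := E j; apply.
by rewrite lt; apply/forallP => j; apply/implyP => /E ->.
Qed.

Lemma lex_lt_irr m : lex_lt m m = false.
Proof. by apply/lex_ltP => -[i]; rewrite ltnn. Qed.

Lemma lex_lt_trans : transitive (@lex_lt n).
Proof.
move=> m2 m1 m3 /lex_ltP [i lt12 E12] /lex_ltP [j lt23 E23]; apply/lex_ltP.
case: (ltngtP i j) => ij.
- by exists j => [|k jk]; rewrite E12 // ?E23 // (ltn_trans ij jk).
- by exists i => [|k ik]; rewrite -E23 // ?E12 // ?(ltn_trans ij ik).
- have {}ij : i = j by apply: val_inj.
  subst j; exists i => [|k ik]; first exact: ltn_trans lt12 lt23.
  by rewrite E12 // E23.
Qed.

Lemma lex_le_trans : transitive (@lex_le n).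
Proof.
move=> m2 m1 m3 /orP [/eqP -> //|lt12] /orP [/eqP <-|lt23];
  apply/orP; right => //.
exact: lex_lt_trans lt12 lt23.
Qed.

Lemma lex_le_anti : antisymmetric (@lex_le n).
Proof.
move=> m1 m2 /andP [/orP [/eqP //|lt12] /orP [/eqP //|lt21]].
by have := lex_lt_trans lt12 lt21; rewrite lex_lt_irr.
Qed.

Lemma lex_le_total : total (@lex_le n).
Proof.
move=> m1 m2; rewrite /lex_le; have [-> //|ne] := eqVneq m1 m2; rewrite /=.
have [i0 ne0] : exists i, m1 i != m2 i.
  apply/existsP; rewrite -negb_forall; apply: contra ne => /forallP E.
  by apply/eqP/mnmP => i; apply/eqP.
pose i := [arg max_(i > i0 | m1 i != m2 i) (i : nat)]%N.
have [nei top] : m1 i != m2 i /\ forall j : 'I_n, (i < j)%N -> m1 j = m2 j.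
  rewrite /i; case: arg_maxnP => // k nek top; split=> // j kj.
  by apply/eqP; apply: contraLR kj => /top; rewrite -leqNgt.
apply/orP; case: (ltngtP (m1 i) (m2 i)) nei => // lt _; [left|right].
- by apply/lex_ltP; exists i.
- by apply/lex_ltP; exists i => // j /top ->.
Qed.

Lemma lex_le_add m m1 m2 : lex_le m1 m2 -> lex_le (m + m1)%MM (m + m2)%MM.
Proof.
rewrite /lex_le => /orP [/eqP ->|/lex_ltP [i lt E]]; first by rewrite eqxx.
apply/orP; right.
apply/lex_ltP; exists i => [|j ij]; rewrite !mnmDE ?ltn_add2l //.
by rewrite E.
Qed.

Lemma lex_le_ge0 m : lex_le 0%MM m.
Proof.
have /orP [//|/orP [/eqP ->|/lex_ltP [i]]] := lex_le_total 0%MM m.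
  by rewrite /lex_le eqxx.
by rewrite mnm0E.
Qed.

Definition lex_order : monomial_order n :=
  MonomialOrder lex_le_anti lex_le_trans lex_le_total lex_le_add lex_le_ge0.

End Lex.

Section Groebner.
Variables (n : nat) (R : comNzRingType) (ord : monomial_order n).
Implicit Types (P I : {mpoly R[n]} -> Prop) (G : seq {mpoly R[n]}).

Definition mo_max (m1 m2 : 'X_{1..n}) := if ord m1 m2 then m2 else m1.

(* As 0%MM is the least monomial, this is the largest element of the support
   of a nonzero f, see [lmonP]. *)
Definition lmon (f : {mpoly R[n]}) : 'X_{1..n} :=
  \big[mo_max/0%MM]_(m <- msupp f) m.

Lemma lmonP (f : {mpoly R[n]}) : f != 0 ->
  lmon f \in msupp f /\ (forall m, m \in msupp f -> ord m (lmon f)).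
Proof.
rewrite -msupp_eq0 /lmon.
have ordr m : ord m m by have := mo_total ord m m; rewrite orbb.
have maxl m1 m2 : ord m1 (mo_max m1 m2) by rewrite /mo_max; case: ifP.
have maxr m1 m2 : ord m2 (mo_max m1 m2).
  rewrite /mo_max; case: ifP => // m12.
  by have := mo_total ord m1 m2; rewrite m12.
move=> s_n0; split; last first.
  elim: (msupp f : seq _) => // m0 s IHs m; rewrite inE big_cons.
  by case/predU1P => [-> //|/IHs ms]; apply: mo_trans ms _.
move: s_n0; elim: (msupp f : seq _) => // m0 [|m1 s] IHs _.
  rewrite big_cons big_nil inE /mo_max; case: ifP => // m0_le0.
  by apply/eqP/(@mo_anti _ ord); rewrite m0_le0 mo_ge0.
rewrite big_cons {1}/mo_max; case: ifP => _; last by rewrite inE eqxx.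
by rewrite inE IHs ?orbT.
Qed.

Definition lead_ideal P : {mpoly R[n]} -> Prop :=
  ideal_gen (fun h => exists f, [/\ P f, f != 0 & h = 'X_[lmon f]]).

Definition groebner_basis I G : Prop :=
  (forall f, I f <-> ideal_gen (fun g => g \in G) f) /\
  (forall h, lead_ideal I h <-> lead_ideal (fun g => g \in G) h).

(* "Any other monomial occurring in the polynomials of G" refers to
   occurrences: the leading monomial of g may not occur in another element of
   G either. *)
Definition reduced_groebner_basis I G : Prop :=
  groebner_basis I G /\
  forall g, g \in G ->
    g@_(lmon g) = 1 /\
    forall h m, h \in G -> m \in msupp h -> (h, m) != (g, lmon g) ->
      ~~ (lmon g <= m)%MM.

End Groebner.

(* Main.v *)
(* Each relation reads x_k^2 = r_k with r_k a polynomial in the x_j, j < k.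
   Replacing x_k^(2c + e), e in {0, 1}, by r_k^c x_k^e is an R-linear map that
   commutes with multiplication by polynomials free of x_k and kills every
   multiple of x_k^2 - r_k. Composing these maps, the largest index first, gives
   a linear normal form with squarefree support that vanishes on the ideal, is
   the identity on squarefree polynomials, is congruent to the identity modulo
   the ideal, and does not increase monomials for lex. Hence the squarefree
   monomials form a basis of the quotient, and the lex-leading monomial of a
   nonzero element of the ideal is not squarefree, i.e. is divisible by some
   x_k^2, the leading monomial of x_k^2 - r_k. *)
Require Import Defs.
From HB Require Import structures.
From mathcomp Require Import all_boot all_order all_algebra.
From mathcomp Require Import reals.
From mathcomp Require Import mpoly.
From mathcomp Require Import ssrcomplements.

Set Implicit Arguments.
Unset Strict Implicit.
Unset Printing Implicit Defensive.

Import GRing.Theory.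
Local Open Scope ring_scope.

(** * Polynomials with constrained support, and linear extension from monomials *)

Section Supports.
Variables (n : nat) (R : comNzRingType).
Implicit Types (Q : {pred 'X_{1..n}}) (f g : {mpoly R[n]}) (m : 'X_{1..n}).

(** A boolean collective predicate, so that it can carry a submodule structure and support
    conditions pass through sums by the [rpred] lemmas. *)
Definition supp_in Q : {pred {mpoly R[n]}} := fun f => all Q (msupp f).

Lemma supp_inP Q f :
  reflect (forall m, m \in msupp f -> Q m) (f \in supp_in Q).
Proof. exact: allP. Qed.

Lemma supp_in_submod_closed Q : submod_closed (supp_in Q).
Proof.
split=> [|a f g /supp_inP Qf /supp_inP Qg]; apply/supp_inP => m.
  by rewrite msupp0.
move/msuppD_le; rewrite mem_cat => /orP [/msuppZ_le|]; [exact: Qf|exact: Qg].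
Qed.

HB.instance Definition _ Q :=
  GRing.isSubmodClosed.Build R {mpoly R[n]} (supp_in Q)
    (supp_in_submod_closed Q).

Lemma supp_inX Q m : ('X_[m] \in supp_in Q) = Q m.
Proof. by rewrite unfold_in msuppX /= andbT. Qed.

Lemma supp_inM Q1 Q2 Q f g :
  (forall m1 m2, Q1 m1 -> Q2 m2 -> Q (m1 + m2)%MM) ->
  f \in supp_in Q1 -> g \in supp_in Q2 -> f * g \in supp_in Q.
Proof.
move=> QD /supp_inP Qf /supp_inP Qg; apply/supp_inP => m /msuppM_le.
by case/allpairsP => -[m1 m2] /= [/Qf ? /Qg ? ->]; apply: QD.
Qed.

Lemma supp_in_exp Q f c :
  Q 0%MM -> (forall m1 m2, Q m1 -> Q m2 -> Q (m1 + m2)%MM) ->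
  f \in supp_in Q -> f ^+ c \in supp_in Q.
Proof.
move=> Q0 QD Qf; elim: c => [|c IHc]; first by rewrite expr0 -mpolyX0 supp_inX.
by rewrite exprS (supp_inM QD).
Qed.

Lemma sub_supp_in Q1 Q2 f :
  (forall m, Q1 m -> Q2 m) -> f \in supp_in Q1 -> f \in supp_in Q2.
Proof. by move=> Q12 /supp_inP Qf; apply/supp_inP => m /Qf /Q12. Qed.

Lemma mcoeff_supp_in Q f m : f \in supp_in Q -> ~~ Q m -> f@_m = 0.
Proof.
by move=> /supp_inP Qf; apply: contraNeq; rewrite -mcoeff_msupp => /Qf.
Qed.

Definition mlin (h : 'X_{1..n} -> {mpoly R[n]}) f : {mpoly R[n]} :=
  \sum_(m <- msupp f) f@_m *: h m.

Lemma mlinE h d f : (msize f <= d)%N ->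
  mlin h f = \sum_(m : 'X_{1..n < d}) f@_m *: h m.
Proof.
move=> le_fd; rewrite /mlin (big_mksub 'X_{1..n < d}) ?msupp_uniq //=.
  rewrite big_rmcond //= => j /memN_msupp_eq0 ->.
  by rewrite scale0r.
by move=> m /msize_mdeg_lt /leq_trans; apply.
Qed.

Lemma mlin_is_linear h : linear (mlin h).
Proof.
move=> a f g.
(* One degree bound for all three polynomials, so that the three sums range over the same
   monomials. *)
pose d := maxn (msize (a *: f + g)) (maxn (msize f) (msize g)).
rewrite !(@mlinE h d) ?leq_max ?leqnn ?orbT // scaler_sumr -big_split.
apply: eq_bigr => m _ /=.
by rewrite mcoeffD mcoeffZ scalerDl scalerA.
Qed.

HB.instance Definition _ h :=
  GRing.isLinear.Build R {mpoly R[n]} {mpoly R[n]} *:%R (mlin h)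
    (mlin_is_linear h).

Lemma mlinX h m : mlin h 'X_[m] = h m.
Proof. by rewrite /mlin msuppX big_seq1 mcoeffX eqxx scale1r. Qed.

End Supports.

(** * Closure properties of ideals and a criterion for leading monomials *)

Section IdealClosure.
Variables (n : nat) (R : comNzRingType).
Implicit Types (P : {mpoly R[n]} -> Prop) (f g : {mpoly R[n]}).

Lemma ideal_pred_gen P f : P f -> f \in ideal_pred P.
Proof.
move=> Pf; apply/ideal_predP; exists [:: (1, f)]; rewrite big_seq1 mul1r.
by split=> // p; rewrite inE => /eqP ->.
Qed.

Lemma ideal_predM P f g : f \in ideal_pred P -> g * f \in ideal_pred P.
Proof. by move=> /ideal_predP If; apply/ideal_predP/ideal_genM. Qed.

Lemma ideal_predZ P a f : f \in ideal_pred P -> a *: f \in ideal_pred P.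
Proof. by rewrite -mul_mpolyC; apply: ideal_predM. Qed.

Lemma ideal_gen_min P1 P2 :
  (forall f, P1 f -> ideal_gen P2 f) ->
  forall f, ideal_gen P1 f -> ideal_gen P2 f.
Proof.
move=> P12 _ [s [Ps ->]]; apply/ideal_predP; rewrite big_seq.
apply: rpred_sum => p /Ps /P12 /ideal_predP; exact: ideal_predM.
Qed.

Lemma lead_ideal_mono (ord : monomial_order n) P1 P2 :
  (forall f, P1 f -> P2 f) ->
  forall f, lead_ideal ord P1 f -> lead_ideal ord P2 f.
Proof.
move=> P12 f [s [Ps ->]]; exists s; split=> // p /Ps [g [Pg g0 pE]].
by exists g; split=> //; apply: P12.
Qed.

Lemma lmon_eq (ord : monomial_order n) f m :
  f@_m != 0 -> f \in supp_in (fun m' => ord m' m) -> lmon ord f = m.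
Proof.
move=> fm /supp_inP le_m.
have f0 : f != 0 by apply: contraNneq fm => ->; rewrite mcoeff0.
have [lf max_f] := lmonP ord f0.
apply: (@mo_anti _ ord); rewrite le_m //= max_f //.
by rewrite mcoeff_msupp.
Qed.

End IdealClosure.

(** * Elimination of squares and the squarefree normal form *)

Section SquareElimination.
Variables (n : nat) (R : comNzRingType) (r : 'I_n -> {mpoly R[n]}).
Implicit Types (i j k : 'I_n) (m : 'X_{1..n}) (f g : {mpoly R[n]}).

Definition mnm_below (k : 'I_n) (m : 'X_{1..n}) : bool :=
  [forall j : 'I_n, (k <= j)%N ==> (m j == 0%N)].

Hypothesis r_below : forall k, r k \in supp_in (mnm_below k).

Definition sq_rel (k : 'I_n) : {mpoly R[n]} := 'X_k ^+ 2 - r k.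

Definition par_mnm (k : 'I_n) (m : 'X_{1..n}) : 'X_{1..n} :=
  [multinom if j == k then odd (m j) : nat else m j | j < n].

Definition elim_sq (k : 'I_n) : {mpoly R[n]} -> {mpoly R[n]} :=
  mlin (fun m => 'X_[par_mnm k m] * r k ^+ (m k)./2).

HB.instance Definition _ k := GRing.Linear.on (elim_sq k).

Lemma mnm_belowP k m :
  reflect (forall j : 'I_n, (k <= j)%N -> m j = 0%N) (mnm_below k m).
Proof.
apply: (iffP forallP) => [Bm j kj|Bm j]; last by apply/implyP => /Bm ->.
by have /implyP/(_ kj)/eqP := Bm j.
Qed.

Lemma mnm_belowD k m1 m2 :
  mnm_below k m1 -> mnm_below k m2 -> mnm_below k (m1 + m2)%MM.
Proof.
move=> /mnm_belowP B1 /mnm_belowP B2; apply/mnm_belowP => j kj.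
by rewrite mnmDE B1 ?B2.
Qed.

Lemma r_exp_below k c : r k ^+ c \in supp_in (mnm_below k).
Proof.
apply: supp_in_exp => //; last exact: mnm_belowD.
by apply/mnm_belowP => j _; rewrite mnm0E.
Qed.

Lemma elim_sqX k m : elim_sq k 'X_[m] = 'X_[par_mnm k m] * r k ^+ (m k)./2.
Proof. exact: mlinX. Qed.

Lemma par_mnm_id k m : (m k <= 1)%N -> par_mnm k m = m.
Proof.
move=> mk; apply/mnmP => j; rewrite mnmE; case: eqP => // ->.
by case: (m k) mk => [|[]].
Qed.

Lemma elim_sq_id k f : f \in supp_in (fun m => m k <= 1)%N -> elim_sq k f = f.
Proof.
move=> /supp_inP fk; rewrite [f in RHS]mpolyE {1}[f]mpolyE linear_sum /=.
apply: eq_big_seq => m /fk mk; rewrite linearZ /= elim_sqX par_mnm_id //.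
by case: (m k) mk => [|[]] //; rewrite expr0 mulr1.
Qed.

(** By bilinearity it suffices to take monomials, where a factor free of x_k changes neither the
    parity nor the half of the exponent of x_k. *)
Lemma elim_sqM k g f : g \in supp_in (fun m => m k == 0%N) ->
  elim_sq k (g * f) = g * elim_sq k f.
Proof.
move=> /supp_inP gk; rewrite [g]mpolyE !mulr_suml linear_sum /=.
apply: eq_big_seq => m /gk /eqP mk.
rewrite -!scalerAl linearZ; congr (_ *: _).
rewrite [f]mpolyE mulr_sumr !linear_sum mulr_sumr /=; apply: eq_bigr => m' _.
rewrite -scalerAr !linearZ -scalerAr -mpolyXD; congr (_ *: _).
rewrite /= !elim_sqX mulrA -mpolyXD mnmDE mk; congr ('X_[_] * _).
by apply/mnmP => j; rewrite mnmDE !mnmE; case: eqP => // ->; rewrite mk.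
Qed.

(** Two more in the exponent of x_k keep its parity and raise its half by one, hence one more factor
    [r k]. *)
Lemma elim_sqXX k f : elim_sq k ('X_k ^+ 2 * f) = r k * elim_sq k f.
Proof.
rewrite [f]mpolyE mulr_sumr !linear_sum mulr_sumr /=; apply: eq_bigr => m _.
rewrite -scalerAr !linearZ -scalerAr mpolyXn -mpolyXD; congr (_ *: _).
rewrite /= !elim_sqX mulrCA -exprS; congr ('X_[_] * _ ^+ _); last first.
  by rewrite mnmDE mulmnE mnm1E eqxx.
apply/mnmP => j; rewrite [LHS]mnmE [RHS]mnmE mnmDE mulmnE mnm1E.
by case: (eqVneq j k) => [->|/negPf]; rewrite ?eqxx ?oddD // eq_sym => ->.
Qed.

Lemma elim_sq_rel k f : elim_sq k (sq_rel k * f) = 0.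
Proof.
rewrite mulrBl linearB /= elim_sqXX elim_sqM ?subrr //.
by apply: sub_supp_in (r_below k) => m /mnm_belowP ->.
Qed.

Lemma elim_sqM_rel j k f : (k < j)%N ->
  elim_sq j (sq_rel k * f) = sq_rel k * elim_sq j f.
Proof.
move=> kj; apply: elim_sqM; apply: rpredB.
  rewrite mpolyXn supp_inX mulmnE mnm1E.
  by rewrite -[k == j]val_eqE (ltn_eqF kj).
by apply: sub_supp_in (r_below k) => m /mnm_belowP -> //; apply: ltnW.
Qed.

(** On a monomial with x_k-exponent 2c + e the difference has the factor
    [('X_k ^+ 2) ^+ c - r k ^+ c], which [sq_rel k] divides. *)
Lemma elim_sq_cong (k : 'I_n) f :
  f - elim_sq k f \in ideal_pred (fun g => g \in codom sq_rel).
Proof.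
rewrite [f]mpolyE [elim_sq _ _]linear_sum -sumrB; apply: rpred_sum => m _.
rewrite linearZ -scalerBr ideal_predZ //= elim_sqX.
have {1}-> : m = (par_mnm k m + U_(k) *+ 2 *+ (m k)./2)%MM.
  apply/mnmP => j; rewrite mnmDE !mulmnE mnm1E mnmE eq_sym.
  case: eqP => [->|_]; last by rewrite addn0.
  by rewrite mul1n mul2n odd_double_half.
rewrite mpolyXD -!mpolyXn -mulrBr subrXX mulrA mulrAC ideal_predM //.
by apply/ideal_pred_gen/codom_f.
Qed.

(** An exponent of x_k that is at least 2 drops to its parity, while powers of [r k] bring in only
    smaller variables, so the monomials go down for lex. The last two conjuncts let squarefreeness
    accumulate as the indices are eliminated in decreasing order. *)
Lemma elim_sqX_support k m :
  elim_sq k 'X_[m] \in supp_in (fun m' =>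
    [&& lex_le m' m, (m' k <= 1)%N &
        [forall j : 'I_n, (k < j)%N ==> (m' j == m j)]]).
Proof.
rewrite elim_sqX; have [mk|mk] := leqP (m k) 1.
  have -> : (m k)./2 = 0%N by case: (m k) mk => [|[]].
  rewrite expr0 mulr1 par_mnm_id // supp_inX /lex_le eqxx mk /=.
  by apply/forallP => j; rewrite eqxx implybT.
apply: (@supp_inM _ _ (pred1 (par_mnm k m)) (mnm_below k));
  rewrite ?supp_inX /= ?r_exp_below // => _ m' /eqP -> /mnm_belowP Bm'.
have Ek : (par_mnm k m + m')%MM k = odd (m k).
  by rewrite mnmDE mnmE eqxx Bm' // addn0.
have Ej (j : 'I_n) : (k < j)%N -> (par_mnm k m + m')%MM j = m j.
  move=> kj; rewrite mnmDE mnmE Bm' 1?ltnW // addn0.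
  by rewrite -[j == k]val_eqE (gtn_eqF kj).
apply/and3P; split.
- apply/orP; right; apply/lex_ltP; exists k => //.
  by rewrite Ek; case: odd => //; apply: ltnW.
- by rewrite Ek; case: odd.
- by apply/forallP => j; apply/implyP => /Ej ->.
Qed.

Lemma elim_sq_support (Q Q' : {pred 'X_{1..n}}) k f :
  (forall m m' : 'X_{1..n}, Q m -> lex_le m' m -> (m' k <= 1)%N ->
     (forall j : 'I_n, (k < j)%N -> m' j = m j) -> Q' m') ->
  f \in supp_in Q -> elim_sq k f \in supp_in Q'.
Proof.
move=> QQ' /supp_inP Qf; rewrite [f]mpolyE linear_sum big_seq.
apply: rpred_sum => m /Qf Qm; rewrite linearZ rpredZ //=.
apply: sub_supp_in (elim_sqX_support k m) => m' /and3P [le_m' m'k /forallP E].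
by apply: QQ' Qm le_m' m'k _ => j kj; have /implyP/(_ kj)/eqP := E j.
Qed.

(* The largest index is eliminated first: [elim_sq k] creates only variables
   of index smaller than k. *)
Definition elim_seq (s : seq 'I_n) (f : {mpoly R[n]}) : {mpoly R[n]} :=
  foldr elim_sq f s.

Lemma elim_seq_is_linear s : linear (elim_seq s).
Proof. by move=> a f g; elim: s => //= k s ->; rewrite linearP. Qed.

HB.instance Definition _ s :=
  GRing.isLinear.Build R {mpoly R[n]} {mpoly R[n]} *:%R (elim_seq s)
    (elim_seq_is_linear s).

Definition sq_nf : {mpoly R[n]} -> {mpoly R[n]} := elim_seq (enum 'I_n).

HB.instance Definition _ := GRing.Linear.on sq_nf.

Definition sqfree (m : 'X_{1..n}) : bool := [forall i, (m i <= 1)%N].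

(** With [foldr], this makes the larger indices act first; the pairwise form compares each index
    with all those eliminated before it. *)
Lemma enum_ord_pairwise :
  pairwise (fun i j : 'I_n => (i < j)%N) (enum 'I_n).
Proof.
rewrite -(pairwise_map (@nat_of_ord n) ltn) val_enum_ord.
by rewrite -(sorted_pairwise ltn_trans) iota_ltn_sorted.
Qed.

(** The eliminations of larger indices commute with multiplication by [sq_rel k]; then [elim_sq k]
    gives 0, which the remaining ones preserve by linearity. *)
Lemma sq_nf_rel k f : sq_nf (sq_rel k * f) = 0.
Proof.
rewrite /sq_nf; have := enum_ord_pairwise.
have /splitPr [s1 s2] : k \in enum 'I_n by rewrite mem_enum.
rewrite pairwise_cat => /and3P [_ _ /= /andP [ks2 _]].
rewrite /elim_seq foldr_cat /= -/(elim_seq s2 _) -/(elim_seq s1 _).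
have -> : elim_seq s2 (sq_rel k * f) = sq_rel k * elim_seq s2 f.
  elim: s2 ks2 => //= j s2 IHs /andP [kj /IHs ->]; exact: elim_sqM_rel.
by rewrite elim_sq_rel linear0.
Qed.

Lemma sq_nf_ideal f :
  f \in ideal_pred (fun g => g \in codom sq_rel) -> sq_nf f = 0.
Proof.
move=> /ideal_predP [s [Ps ->]]; rewrite linear_sum big_seq big1 //=.
by move=> p /Ps /codomP [k ->]; rewrite mulrC sq_nf_rel.
Qed.

Lemma sq_nf_cong f :
  f - sq_nf f \in ideal_pred (fun g => g \in codom sq_rel).
Proof.
rewrite /sq_nf; elim: (enum 'I_n) => /= [|k s IHs].
  by rewrite subrr rpred0.
by rewrite -(subrKA (elim_seq s f)) rpredD // elim_sq_cong.
Qed.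

Lemma sq_nf_id f : f \in supp_in sqfree -> sq_nf f = f.
Proof.
move=> Sf; rewrite /sq_nf; elim: (enum 'I_n) => //= k s ->.
by apply: elim_sq_id; apply: sub_supp_in Sf => m /forallP.
Qed.

Lemma sq_nf_sqfree f : sq_nf f \in supp_in sqfree.
Proof.
(* Bounding only the exponents of the listed indices gives an invariant for induction on the list:
   eliminating k bounds its exponent and fixes those of larger indices. *)
suff : sq_nf f \in supp_in (fun m => all (fun i => m i <= 1)%N (enum 'I_n)).
  apply: sub_supp_in => m /allP m1; apply/forallP => i.
  by apply: m1; rewrite mem_enum.
rewrite /sq_nf; elim: (enum 'I_n) enum_ord_pairwise => [_|k s IHs] /=.
  exact/supp_inP.
case/andP => ks /IHs; apply: elim_sq_support => m m' /allP m1 _ -> E /=.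
by apply/allP => j js; rewrite E ?m1 // (allP ks).
Qed.

Lemma sq_nf_lex_le m f :
  f \in supp_in (fun m' => lex_le m' m) ->
  sq_nf f \in supp_in (fun m' => lex_le m' m).
Proof.
move=> le_f; rewrite /sq_nf; elim: (enum 'I_n) => //= k s.
apply: elim_sq_support => m1 m2 le1 le2 _ _; exact: lex_le_trans le2 le1.
Qed.

(** A monomial strictly below m has a normal form strictly below m, so it contributes nothing at m;
    m itself is fixed. *)
Lemma mcoeff_sq_nf f m : sqfree m -> f \in supp_in (fun m' => lex_le m' m) ->
  (sq_nf f)@_m = f@_m.
Proof.
move=> Sm /supp_inP le_f; rewrite [f in RHS]mpolyE {1}[f]mpolyE.
rewrite !linear_sum /=; apply: eq_big_seq => m' /le_f le_m'.
rewrite linearZ !mcoeffZ; congr (_ * _) => /=.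
have [->|ne] := eqVneq m' m; first by rewrite sq_nf_id // supp_inX.
rewrite [in RHS]mcoeffX (negPf ne).
apply: (@mcoeff_supp_in _ _ (fun m1 => lex_le m1 m')).
  by apply: sq_nf_lex_le; rewrite supp_inX /lex_le eqxx.
apply: contra ne => le_m; apply/eqP/lex_le_anti.
by rewrite le_m'.
Qed.

(** A squarefree leading monomial would keep its nonzero coefficient in the normal form, which is 0
    on the ideal. *)
Lemma lmon_not_sqfree f : f != 0 ->
  f \in ideal_pred (fun g => g \in codom sq_rel) ->
  ~~ sqfree (lmon (lex_order n) f).
Proof.
move=> f0 /sq_nf_ideal nf0; have [lf max_f] := lmonP (lex_order n) f0.
apply: contraL lf => Sl; rewrite -mcoeff_eq0 -mcoeff_sq_nf ?nf0 ?mcoeff0 //.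
exact/supp_inP.
Qed.

(** * Leading monomials and Gröbner bases *)

Lemma below_lex_lt k m : mnm_below k m -> lex_lt m (U_(k) *+ 2)%MM.
Proof.
move=> /mnm_belowP Bm; apply/lex_ltP; exists k => [|j kj].
  by rewrite Bm // mulmnE mnm1E eqxx.
by rewrite Bm 1?ltnW // mulmnE mnm1E -[k == j]val_eqE (ltn_eqF kj).
Qed.

Lemma mcoeff_sq_rel k : (sq_rel k)@_(U_(k) *+ 2) = 1.
Proof.
rewrite mcoeffB mcoeffXn eqxx (mcoeff_supp_in (r_below k)) ?subr0 //.
apply/negP => /below_lex_lt; by rewrite lex_lt_irr.
Qed.

Lemma sq_rel_neq0 k : sq_rel k != 0.
Proof.
apply: contra_eq_neq (mcoeff_sq_rel k) => ->.
by rewrite mcoeff0 eq_sym oner_neq0.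
Qed.

Lemma lmon_sq_rel k : lmon (lex_order n) (sq_rel k) = (U_(k) *+ 2)%MM.
Proof.
apply: lmon_eq; first by rewrite mcoeff_sq_rel oner_neq0.
apply: rpredB; first by rewrite mpolyXn supp_inX /= /lex_le eqxx.
apply: sub_supp_in (r_below k) => m /below_lex_lt lt_m.
by rewrite /= /lex_le lt_m orbT.
Qed.

Lemma sq_rel_groebner :
  groebner_basis (lex_order n) (ideal_gen (fun g => g \in codom sq_rel))
    (codom sq_rel).
Proof.
split=> // h; split; last first.
  by apply: lead_ideal_mono => f Gf; apply/ideal_predP/ideal_pred_gen.
apply: ideal_gen_min => _ [f [/ideal_predP If f0 ->]].
have /forallPn [k] := lmon_not_sqfree f0 If.
rewrite -ltnNge => lk.
have /submK <- : (U_(k) *+ 2 <= lmon (lex_order n) f)%MM.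
  apply/mnm_lepP => j; rewrite mulmnE mnm1E.
  by case: eqP => // <-.
rewrite mpolyXD -lmon_sq_rel; apply/ideal_genM/ideal_predP/ideal_pred_gen.
by exists (sq_rel k); rewrite codom_f sq_rel_neq0.
Qed.

Lemma sq_rel_reduced : (forall k, r k \in supp_in sqfree) ->
  reduced_groebner_basis (lex_order n)
    (ideal_gen (fun g => g \in codom sq_rel)) (codom sq_rel).
Proof.
move=> Sr; split; first exact: sq_rel_groebner.
move=> _ /codomP [k ->]; rewrite lmon_sq_rel mcoeff_sq_rel; split=> //.
(* The monomial m is x_l^2 or occurs in [r l]. In the second case it is squarefree, so x_k^2 cannot
   divide it. *)
move=> _ m /codomP [l ->] /msuppB_le; rewrite mem_cat mpolyXn.
case/orP => [/mem_msuppXP <-|ml _]; last first.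
  apply/negP => /mnm_lepP /(_ k); rewrite mulmnE mnm1E eqxx.
  by have /supp_inP/(_ m ml)/forallP/(_ k) := Sr l; rewrite leqNgt => /negP.
(* If x_k^2 divides x_l^2 then l = k, which is the excluded occurrence. *)
apply: contra => /mnm_lepP /(_ k); rewrite !mulmnE !mnm1E eqxx.
by case: eqP => // ->.
Qed.

(** * The squarefree basis of the quotient *)

Lemma sqfree_mnm_sqfree e : sqfree (@sqfree_mnm n e).
Proof. by apply/forallP => i; rewrite mnmE; case: (e i). Qed.

Lemma sqfree_mnm_inj : injective (@sqfree_mnm n).
Proof.
move=> e1 e2 /mnmP E; apply/ffunP => i; have := E i; rewrite !mnmE.
by case: (e1 i); case: (e2 i).
Qed.

Lemma sqfree_mnmE f : f \in supp_in sqfree ->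
  f = \sum_e f@_(sqfree_mnm e) *: 'X_[sqfree_mnm e].
Proof.
move=> Sf; apply/mpolyP => m; rewrite linear_sum /=.
under eq_bigr => e _ do rewrite mcoeffZ mcoeffX.
have [Sm|NSm] := boolP (sqfree m); last first.
  rewrite (mcoeff_supp_in Sf NSm) big1 // => e _.
  case: eqP => [mE|_]; last by rewrite mulr0.
  by rewrite -mE sqfree_mnm_sqfree in NSm.
have -> : m = sqfree_mnm [ffun i => m i == 1%N].
  apply/mnmP => i; rewrite mnmE ffunE.
  by have /forallP/(_ i) := Sm; case: (m i) => [|[]].
rewrite (bigD1 [ffun i => m i == 1%N]) //= eqxx mulr1 big1 ?addr0 // => e ne.
by rewrite (inj_eq sqfree_mnm_inj) (negPf ne) mulr0.
Qed.

Local Notation gens := (fun g => g \in codom sq_rel).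

Lemma quot_pi0 : (\pi_(mpoly_quot gens) 0)%qT = 0.
Proof. exact: (raddf0 (\pi_(Quotient.quot (ideal_pred gens)))%qT). Qed.

Lemma sum_quot_pi (I : finType) (a : I -> R) (b : I -> {mpoly R[n]}) :
  \sum_i a i *: (\pi_(mpoly_quot gens) (b i))%qT =
  (\pi_(mpoly_quot gens) (\sum_i a i *: b i))%qT.
Proof.
rewrite (big_morph _ (@quot_piD _ _ gens) quot_pi0); apply: eq_bigr => i _.
exact: quot_scale_pi.
Qed.

Lemma sqfree_is_basis :
  is_basis (fun e : {ffun 'I_n -> bool} =>
    (\pi_(mpoly_quot gens) 'X_[R, sqfree_mnm e])%qT).
Proof.
split=> [a|v].
  rewrite sum_quot_pi.
  set f := \sum_e _ => f0.
  (* The normal form both kills f, an element of the ideal, and fixes it, a squarefree polynomial;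
     hence f = 0. *)
  have /sq_nf_ideal : f \in ideal_pred gens.
    by rewrite -[f]subr0; apply/quot_eqP; rewrite quot_pi0.
  rewrite sq_nf_id => [fE e|]; last first.
    by apply: rpred_sum => e _; rewrite rpredZ // supp_inX sqfree_mnm_sqfree.
  have := congr1 (mcoeff (sqfree_mnm e)) fE.
  rewrite linear_sum mcoeff0 (bigD1 e) //= mcoeffZ mcoeffX eqxx mulr1.
  rewrite big1 ?addr0 // => e' ne.
  by rewrite mcoeffZ mcoeffX (inj_eq sqfree_mnm_inj) (negPf ne) mulr0.
exists (fun e => (sq_nf (repr v))@_(sqfree_mnm e)).
rewrite sum_quot_pi -sqfree_mnmE ?sq_nf_sqfree // -[LHS]reprK.
exact/quot_eqP/sq_nf_cong.
Qed.

End SquareElimination.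

(** * Application to the Coxeter polynomials *)

Section CoxeterRelations.
Variables (R : realType) (C : coxeter_system) (n : nat).
Variable w : n.-tuple (cox_gen C).

Local Notation gens := (fun g => g \in codom (cox_poly R w)).
Local Notation gens' := (fun g => g \in codom (cox_poly_red R w)).

Definition cox_tail (k : 'I_n) : {mpoly R[n]} :=
  (\sum_(l < n | (l < k)%N) cox_Q R w l k *: 'X_l) ^+ 2.

Lemma cox_tail_below k : cox_tail k \in supp_in (mnm_below k).
Proof.
apply: supp_in_exp => [|m1 m2|]; last 2 first.
- exact: mnm_belowD.
- apply: rpred_sum => l lk; rewrite rpredZ // supp_inX.
  apply/mnm_belowP => j kj; rewrite mnm1E -val_eqE ltn_eqF //.
  exact: leq_trans lk kj.
by apply/mnm_belowP => j _; rewrite mnm0E.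
Qed.

(** Defined by subtraction, so that q_k' has the form [sq_rel] at once; the content lies in the
    support of this difference. *)
Definition cox_red_tail (k : 'I_n) : {mpoly R[n]} :=
  'X_k ^+ 2 - cox_poly_red R w k.

(** Each diagonal term c_jj x_j^2 of the tail of q_k meets the - c_jj q_j' of the recursion, and
    x_j^2 - q_j' is the reduced tail of index j. *)
Lemma cox_red_tailE k : cox_red_tail k =
  \sum_(j < n | (j < k)%N)
    (\sum_(i < n | (i < j)%N) cox_coef R w k i j *: ('X_i * 'X_j) +
     cox_coef R w k j j *: cox_red_tail j).
Proof.
rewrite {1}/cox_red_tail cox_poly_redE cox_polyE opprD addrA subKr -sumrB.
apply: eq_bigr => j jk; rewrite (bigD1 j) //= scalerBr expr2.
rewrite [X in X - _]addrC -addrA; congr (_ + _).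
by apply: eq_bigl => i; rewrite ltn_neqAle andbC val_eqE.
Qed.

(** Strong induction on k: the products x_i x_j with i < j < k are squarefree, and the other terms
    are multiples of earlier reduced tails. *)
Lemma cox_red_tail_support k :
  cox_red_tail k \in supp_in (fun m => mnm_below k m && sqfree m).
Proof.
have [b] := ubnP (k : nat); elim: b k => // b IHb k kb.
rewrite cox_red_tailE; apply: rpred_sum => j jk; apply: rpredD.
  apply: rpred_sum => i ij; rewrite rpredZ // -mpolyXD supp_inX.
  apply/andP; split.
    apply/mnm_belowP => l kl; rewrite mnmDE !mnm1E -!val_eqE.
    by rewrite !ltn_eqF // (leq_trans _ kl) // (ltn_trans ij).
  apply/forallP => l; rewrite mnmDE !mnm1E.
  by case: (eqVneq i l) => [<-|_]; [rewrite -val_eqE gtn_eqF|case: (j == l)].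
rewrite rpredZ //; have := IHb j (leq_trans jk kb).
apply: sub_supp_in => m /andP [/mnm_belowP Bm ->]; rewrite andbT.
by apply/mnm_belowP => l kl; apply: Bm; apply: ltnW (leq_trans jk kl).
Qed.

Lemma codom_cox_poly_red :
  codom (sq_rel cox_red_tail) = codom (cox_poly_red R w).
Proof. by apply: eq_codom => k; rewrite /sq_rel subKr. Qed.

(** The two families differ by a unitriangular change. The equality of predicates allows rewriting
    inside [reduced_groebner_basis]. *)
Lemma cox_ideal_red : ideal_gen gens = ideal_gen gens'.
Proof.
apply: boolp.funext => f; apply: boolp.propext.
split; apply: ideal_gen_min => {f} _ /codomP [k ->]; apply/ideal_predP.
  have -> : cox_poly R w k = cox_poly_red R w k -
      \sum_(i < n | (i < k)%N) cox_coef R w k i i *: cox_poly_red R w i.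
    by rewrite cox_poly_redE addrK.
  apply: rpredB; last apply: rpred_sum => i _; rewrite ?ideal_predZ //;
    by apply/ideal_pred_gen/codom_f.
(* For the converse, q_k' is q_k plus a combination of earlier q_i', already in the ideal by strong
   induction. *)
have [b] := ubnP (k : nat); elim: b k => // b IHb k kb.
rewrite cox_poly_redE rpredD //; first by apply/ideal_pred_gen/codom_f.
by apply: rpred_sum => i ik; rewrite ideal_predZ // IHb // (leq_trans ik).
Qed.

End CoxeterRelations.

Theorem proposition4p6 (R : realType) (C : coxeter_system) (n : nat)
    (w : n.-tuple (cox_gen C)) :
  let G : seq {mpoly R[n]} := [seq cox_poly R w k | k : 'I_n] in
  let G' : seq {mpoly R[n]} := [seq cox_poly_red R w k | k : 'I_n] in
  let gens : {mpoly R[n]} -> Prop := fun f => f \in G in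
  [/\ groebner_basis (lex_order n) (ideal_gen gens) G,
      reduced_groebner_basis (lex_order n) (ideal_gen gens) G' &
      is_basis (fun e : {ffun 'I_n -> bool} =>
        (\pi_(mpoly_quot gens) 'X_[R, sqfree_mnm e])%qT)].
Proof.
move=> G G' gens; split.
(* [cox_poly] is [sq_rel] of [cox_tail] by unfolding definitions. *)
- exact: (sq_rel_groebner (cox_tail_below R w)).
- have tail_below k : cox_red_tail R w k \in supp_in (mnm_below k).
    by apply: sub_supp_in (cox_red_tail_support R w k) => m /andP [].
  have tail_sqfree k : cox_red_tail R w k \in supp_in (@sqfree n).
    by apply: sub_supp_in (cox_red_tail_support R w k) => m /andP [].
  have := sq_rel_reduced tail_below tail_sqfree.
  by rewrite codom_cox_poly_red -cox_ideal_red.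
- exact: (sqfree_is_basis (cox_tail_below R w)).
Qed.
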